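(* Let $T$ and $T'$ be self-adjoint, nonnegative, compactly resolved operators defined in a Hilbert space $H$, with associated quadratic forms $\mathfrak{t}$ and $\mathfrak{t}'$ and form domains $V$ and $V'$ respectively. If $V'\subset V$ and $\mathfrak{t}(u,u)\leq \mathfrak{t}'(u,u)$ for all $u\in V'$, then $T$ is subspectral to $T'$.
   Context: Operators are linear, possibly unbounded, and densely defined. $T$ is nonnegative if $(Tu,u)\ge 0$ for all $u\in\operatorname{dom}T$. $T$ is compactly resolved if its resolvent operators are compact where defined; then the spectrum of a self-adjoint nonnegative $T$ is a discrete set of eigenvalues of finite multiplicity in $[0,\infty)$. The form domain $V$ of $T$ is the completion of $\operatorname{dom}T$ with respect to the inner product $(u,v)+(Tu,v)$, identified with a subspace of $H$; the associated quadratic form $\mathfrak{t}$ is the continuous extension to $V\times V$ of $(u,v)\mapsto (Tu,v)$. The counting function is $N_T(x)=\#\{\text{eigenvalues of }T\text{ that are}\le x\}$, counted with multiplicity. $T$ is subspectral to $T'$ if $N_T(x)\ge N_{T'}(x)$ for all real $x$. *)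

(* Defs.v *)
From HB Require Import structures.
From mathcomp Require Import all_boot all_order all_algebra.
From mathcomp Require Import complex.
From mathcomp Require Import all_classical all_reals all_analysis.

Set Implicit Arguments.
Unset Strict Implicit.
Unset Printing Implicit Defensive.

Import Order.TTheory GRing.Theory Num.Theory Num.Def.
Import numFieldNormedType.Exports.

Local Open Scope classical_set_scope.
Local Open Scope ring_scope.

(* A Hilbert space is a complete normed space over R[i] whose norm is induced
   by a positive definite sesquilinear form (linear on the left). *)
Definition hilbert_ip (R : realType) (H : completeNormedModType R[i])
    (ip : {dot H for conjC}) : Prop :=
  forall u : H, `|u| ^+ 2 = ip u u.

(* The values of [op_fun] outside [op_dom] are junk: every definition below
   applies it to elements of [op_dom] only. *)
Record operator (K : numFieldType) (H : normedModType K) := Operator {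
  op_dom : set H;
  op_fun :> H -> H;
  op_dom0 : op_dom 0;
  op_domP : forall (a : K) (u v : H),
    op_dom u -> op_dom v -> op_dom (a *: u + v);
  op_linear : forall (a : K) (u v : H),
    op_dom u -> op_dom v -> op_fun (a *: u + v) = a *: op_fun u + op_fun v;
  op_dense : dense op_dom }.

Section Dimension.
Variables (K : numFieldType) (E : lmodType K).

Definition lin_indep (n : nat) (e : 'I_n -> E) : Prop :=
  forall c : 'I_n -> K, \sum_(i < n) c i *: e i = 0 -> forall i, c i = 0.

(* dimension of a linear subspace [S], possibly +oo *)
Definition edim (R : realType) (S : set E) : \bar R :=
  ereal_sup [set n%:R%:E | n in [set n : nat |
    exists e : 'I_n -> E, (forall i, S (e i)) /\ lin_indep e]].

End Dimension.

Section Operators.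
Variables (R : realType) (H : completeNormedModType R[i]).
Implicit Types (T : operator H) (z : R[i]).

Definition compact_map (S : H -> H) : Prop :=
  forall A : set H, bounded_set A -> precompact (S @` A).

(* [S] is the bounded, everywhere defined inverse of T - z *)
Definition is_resolvent T z (S : {linear H -> H}) : Prop :=
  [/\ continuous S,
      forall v, op_dom T (S v) /\ T (S v) - z *: S v = v &
      forall u, op_dom T u -> S (T u - z *: u) = u].

Definition compactly_resolved T : Prop :=
  forall z (S : {linear H -> H}), is_resolvent T z S -> compact_map S.

Definition eigenspace T z : set H := [set u | op_dom T u /\ T u = z *: u].

Definition eigenvalue T z : Prop := exists2 u, eigenspace T z u & u != 0.

(* In R[i], [z <= x%:C] says that z is real and at most x. *)
Definition counting_fun T (x : R) : \bar R :=
  \esum_(z in [set z | eigenvalue T z /\ z <= x%:C%C]) edim R (eigenspace T z).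

Definition subspectral T T' : Prop :=
  forall x : R, (counting_fun T' x <= counting_fun T x)%E.

Variable ip : {dot H for conjC}.

Definition nonnegative T : Prop := forall u, op_dom T u -> 0 <= ip (T u) u.

(* graph of the adjoint, single-valued because [op_dom T] is dense *)
Definition adjoint_graph T : set (H * H) :=
  [set p | forall u, op_dom T u -> ip (T u) p.1 = ip u p.2].

Definition self_adjoint T : Prop :=
  adjoint_graph T = [set p | op_dom T p.1 /\ p.2 = T p.1].

Definition form_ip T (u v : H) : R[i] := ip u v + ip (T u) v.

Definition form_cauchy T (u_ : nat -> H) : Prop :=
  (forall n, op_dom T (u_ n)) /\
  forall e : R[i], 0 < e -> exists N, forall m n, (N <= m)%N -> (N <= n)%N ->
    form_ip T (u_ m - u_ n) (u_ m - u_ n) < e.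

(* An element of the completion of [op_dom T] for [form_ip T] is a class of
   [form_cauchy] sequences; it is identified with their common limit in H. *)
Definition form_represents T (u_ : nat -> H) (u : H) : Prop :=
  form_cauchy T u_ /\ u_ @ \oo --> u.

Definition form_domain T : set H :=
  [set u | exists u_, form_represents T u_ u].

(* The continuous extension of (u, v) |-> (T u, v): for T symmetric and
   nonnegative the limit exists and depends only on u and v.  Junk value 0
   outside of the form domain. *)
Definition qform T (u v : H) : R[i] :=
  xget 0 [set c : R[i] | exists u_ v_ : nat -> H,
    [/\ form_represents T u_ u, form_represents T v_ v &
        (fun n => ip (T (u_ n)) (v_ n) : R[i]^o) @ \oo --> (c : R[i]^o)]].

End Operators.

(* Main.v *)
Require Import Defs.
From HB Require Import structures.
From mathcomp Require Import all_boot all_order all_algebra.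
From mathcomp Require Import complex.
From mathcomp Require Import all_classical all_reals all_analysis.
From mathcomp Require Import ring lra.

Import Order.TTheory GRing.Theory Num.Theory Num.Def.
Import numFieldNormedType.Exports.

Local Open Scope classical_set_scope.
Local Open Scope ring_scope.

(** The proof is the min-max comparison of eigenvalues, organised so that no
eigenbasis of either operator is ever needed.

On the span of finitely many eigenvectors of T' with eigenvalues at most x, one
has t'(u,u) <= x |u|^2, hence t(u,u) <= x |u|^2 by hypothesis
([eigenspaces_independent], [qform_le_op]).  Given such a span of dimension n,
[eigenfamily_exists] produces n pairwise orthogonal eigenvectors of T with
eigenvalues at most x, one at a time.  If v_0, ..., v_(k-1) have been found and
k < n, some u <> 0 in the span is orthogonal to all of them.  Let S be the
inverse of T + 1, which is everywhere defined ([shift_onto]) and compact.  Since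
(u,u) is the form inner product of S u and u, the Cauchy-Schwarz inequality of
the form gives |u|^4 <= (S u,u) (t(u,u) + |u|^2) ([sq_le_resolvent_qform]), so
(S u,u) >= |u|^2 / (x + 1).  The orthogonal complement M of the v_i is invariant
under S, and by compactness the supremum of (S v,v) over the unit vectors v of M
is an eigenvalue mu >= 1 / (x + 1) of S with an eigenvector in M
([eigenvector_ge_quotient]); this is an eigenvector of T for the eigenvalue
1 / mu - 1 <= x.  Thus N_T(x) >= n ([eigenfamily_le_counting]), and N_T'(x) is
the supremum of such n ([counting_le_families]).

The value of the form on its domain is a limit along two arbitrary
representing sequences; its independence of these is the closability of the
form ([form_closable]).  Most estimates only see the real part of the inner
product, so they are carried out over the reals. *)

(** * Two facts about real numbers *)

(** Every Cauchy-Schwarz inequality below is an instance: [a + 2 t b + t^2 c] is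
the value of a positive semidefinite form at [u + t v]. *)
Lemma discriminant_le (R : realType) (a b c : R) : 0 <= c ->
  (forall t, 0 <= a + 2 * t * b + t ^+ 2 * c) -> b ^+ 2 <= a * c.
Proof.
rewrite le_eqVlt => /predU1P[<-|c0] h.
  have [->|b0] := eqVneq b 0; first by rewrite expr0n mulr0.
  have := h (- (a + 1) / (2 * b)); rewrite !mulr0 addr0.
  have -> : a + 2 * (- (a + 1) / (2 * b)) * b = -1 by field.
  by rewrite ler0N1.
have := h (- b / c).
have -> : a + 2 * (- b / c) * b + (- b / c) ^+ 2 * c = (a * c - b ^+ 2) / c.
  by field; rewrite gt_eqF.
by rewrite pmulr_lge0 ?invr_gt0// subr_ge0.
Qed.

Lemma le0_harmonic (R : realType) (x C : R) :
  (forall n, x <= C * harmonic n) -> x <= 0.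
Proof.
move=> h; rewrite -(mulr0 C).
have h1 : (fun=> x) @ \oo --> x by exact: cvg_cst.
have h2 : (fun n => C * harmonic n) @ \oo --> C * 0.
  by apply: cvgMr; exact: cvg_harmonic.
by apply: ler_cvg_to h1 h2 _; apply: nearW.
Qed.

Section RealInnerProduct.
Set Implicit Arguments.
Unset Strict Implicit.
Variables (R : realType) (H : completeNormedModType R[i]).
Variable ip : {dot H for conjC}.
Hypothesis hip : hilbert_ip ip.

(** * The real part of the inner product *)

Lemma ipDl u v w : ip (u + v) w = ip u w + ip v w.
Proof. exact: linearDl. Qed.

Lemma ipZl a u w : ip (a *: u) w = a * ip u w.
Proof. exact: linearZl_LR. Qed.

Lemma ipC u v : ip u v = (ip v u)^*%C.
Proof. by rewrite hermC/= expr0 mul1r. Qed.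

Definition rip (u v : H) : R := complex.Re (ip u v).

(** The squared norm as a real number; it avoids square roots in the estimates. *)
Definition sq (u : H) : R := rip u u.

Lemma ripC u v : rip u v = rip v u.
Proof. by rewrite /rip ipC; case: (ip v u). Qed.

Lemma ripDl u v w : rip (u + v) w = rip u w + rip v w.
Proof. by rewrite /rip ipDl; case: (ip u w) (ip v w) => [? ?] []. Qed.

Lemma ripZl (a : R) u w : rip (a%:C%C *: u) w = a * rip u w.
Proof. by rewrite /rip ipZl; case: (ip u w) => ? ? /=; rewrite mul0r subr0. Qed.

Lemma ripil u w : rip ('i%C *: u) w = - complex.Im (ip u w).
Proof. by rewrite /rip ipZl; case: (ip u w) => ? ? /=; rewrite mul0r mul1r sub0r. Qed.

Lemma ripNl u w : rip (- u) w = - rip u w.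
Proof. by rewrite -scaleN1r -[-1]/(- (1%:C%C)) -raddfN ripZl mulN1r. Qed.

Lemma ripBl u v w : rip (u - v) w = rip u w - rip v w.
Proof. by rewrite ripDl ripNl. Qed.

Lemma ripDr u v w : rip w (u + v) = rip w u + rip w v.
Proof. by rewrite !(ripC w) ripDl. Qed.

Lemma ripZr (a : R) u w : rip w (a%:C%C *: u) = a * rip w u.
Proof. by rewrite !(ripC w) ripZl. Qed.

Lemma ripNr u w : rip w (- u) = - rip w u.
Proof. by rewrite !(ripC w) ripNl. Qed.

Lemma ripBr u v w : rip w (u - v) = rip w u - rip w v.
Proof. by rewrite ripDr ripNr. Qed.

Lemma rip0l w : rip 0 w = 0.
Proof. by rewrite -(scale0r 0) -[0]/(0%:C%C) ripZl mul0r. Qed.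

Lemma ipZr_real (a : R) u v : ip u (a%:C%C *: v) = a%:C%C * ip u v.
Proof.
rewrite ipC ipZl (ipC u v); case: (ip v u) => x y.
by apply/eqP; rewrite eq_complex /= !mul0r !subr0 !addr0 mulrN !eqxx.
Qed.

(** The imaginary part of [ip u v] is the real part of the product with ['i *: v]. *)
Lemma ip_eq0_rip u v : (forall a : R[i], rip u (a *: v) = 0) -> ip u v = 0.
Proof.
move=> h; apply/eqP; rewrite eq_complex /=; apply/andP; split; apply/eqP.
  by have := h 1; rewrite scale1r.
have := h 'i%C; rewrite ripC ripil ipC; case: (ip u v) => x y /=.
by rewrite opprK.
Qed.

Lemma ip_suml (I : finType) (c : I -> R[i]) (e : I -> H) w :
  ip (\sum_i c i *: e i) w = \sum_i c i * ip (e i) w.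
Proof. by rewrite linear_sumlz; apply: eq_bigr => i _; exact: ipZl. Qed.

Lemma ip_sq u : ip u u = (sq u)%:C%C.
Proof.
have : 0 <= ip u u by rewrite -hip exprn_ge0.
by rewrite lecE /= => /andP[/eqP]; rewrite /sq /rip; case: (ip u u) => x y /= ->.
Qed.

Lemma norm_sq u : `|u| ^+ 2 = (sq u)%:C%C.
Proof. by rewrite hip ip_sq. Qed.

Lemma sq_ge0 u : 0 <= sq u.
Proof. by rewrite -lecR -norm_sq exprn_ge0. Qed.

Lemma sq_eq0 u : sq u = 0 -> u = 0.
Proof.
by move=> h; apply/eqP; rewrite -normr_eq0 -sqrf_eq0 norm_sq h.
Qed.

Lemma sq_gt0 u : u != 0 -> 0 < sq u.
Proof.
move=> u0; rewrite lt_neqAle sq_ge0 andbT eq_sym.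
by apply: contra u0 => /eqP/sq_eq0 ->.
Qed.

Lemma sqD u v : sq (u + v) = sq u + 2 * rip u v + sq v.
Proof. by rewrite /sq !(ripDl, ripDr) (ripC v u); ring. Qed.

Lemma sqN u : sq (- u) = sq u.
Proof. by rewrite /sq ripNl ripNr opprK. Qed.

Lemma sqB u v : sq (u - v) = sq u - 2 * rip u v + sq v.
Proof. by rewrite sqD sqN ripNr mulrN. Qed.

Lemma sqZ (a : R) u : sq (a%:C%C *: u) = a ^+ 2 * sq u.
Proof. by rewrite /sq ripZl ripZr mulrA. Qed.

Lemma sqB_le u v : sq (u - v) <= 2 * (sq u + sq v).
Proof. by have := sq_ge0 (u + v); rewrite sqD sqB; lra. Qed.

Lemma rip_cauchy_schwarz u v : rip u v ^+ 2 <= sq u * sq v.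
Proof.
apply: discriminant_le => [|t]; first exact: sq_ge0.
suff -> : sq u + 2 * t * rip u v + t ^+ 2 * sq v = sq (u + t%:C%C *: v).
  exact: sq_ge0.
by rewrite sqD sqZ ripZr; ring.
Qed.

(** * Convergence *)

Lemma complex_gt0E (e : R[i]) : 0 < e -> exists2 r : R, 0 < r & e = r%:C%C.
Proof.
rewrite ltcE /= => /andP[/eqP e0 er]; exists (complex.Re e) => //.
by apply/eqP; rewrite eq_complex /= e0 !eqxx.
Qed.

Lemma norm_lt_sq u (r : R) : 0 < r -> (`|u| < r%:C%C) = (sq u < r ^+ 2).
Proof.
move=> r0; rewrite -(@ltr_pXn2r _ 2%N)// ?nnegrE//; last by rewrite lecR ltW.
by rewrite norm_sq -rmorphXn ltcR.
Qed.

(** Reduces limits in [H], where the norm is complex-valued, to limits of real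
sequences. *)
Lemma cvg_sqP (u_ : nat -> H) (l : H) :
  u_ @ \oo --> l <-> (fun n => sq (u_ n - l)) @ \oo --> (0 : R).
Proof.
rewrite !cvgrPdist_lt; split=> h e e0.
  have := h (Num.sqrt e)%:C%C; rewrite ltcR sqrtr_gt0 => /(_ e0).
  apply: filterS => n; rewrite norm_lt_sq ?sqrtr_gt0// sqr_sqrtr ?ltW//.
  by rewrite sub0r normrN ger0_norm ?sq_ge0// -opprB sqN.
have [r r0 ->] := complex_gt0E e0.
have := h (r ^+ 2); rewrite exprn_gt0// => /(_ isT).
apply: filterS => n; rewrite norm_lt_sq// -(opprB (u_ n)) sqN.
by rewrite sub0r normrN ger0_norm ?sq_ge0.
Qed.

Lemma cvg_sq_lt (u_ : nat -> H) (l : H) : u_ @ \oo --> l ->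
  forall e, 0 < e -> exists N, forall n, (N <= n)%N -> sq (u_ n - l) < e.
Proof.
move=> /cvg_sqP/cvgrPdist_lt h e e0; have [N _ hN] := h e e0.
by exists N => n /hN /=; rewrite sub0r normrN ger0_norm ?sq_ge0.
Qed.

Lemma cvg_sq_harmonic (u_ : nat -> H) (l : H) :
  (forall n, sq (u_ n - l) < harmonic n) -> u_ @ \oo --> l.
Proof.
move=> h; apply/cvg_sqP; apply: (@squeeze_cvgr _ _ _ _ (cst 0) harmonic).
- by apply: nearW => n; rewrite sq_ge0 ltW.
- exact: cvg_cst.
- exact: cvg_harmonic.
Qed.

Lemma cvg_sq_cauchy (u_ : nat -> H) (l : H) : u_ @ \oo --> l ->
  forall e, 0 < e -> exists N, forall m n, (N <= m)%N -> (N <= n)%N ->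
    sq (u_ m - u_ n) < e.
Proof.
move=> ul e e0; have [N hN] := cvg_sq_lt ul (divr_gt0 e0 (ltr0n _ 4)).
exists N => m n /hN hm /hN hn.
have -> : u_ m - u_ n = (u_ m - l) - (u_ n - l) by rewrite opprB addrA subrK.
by apply: le_lt_trans (sqB_le _ _) _; lra.
Qed.

Lemma sq_complete (u_ : nat -> H) :
  (forall e, 0 < e -> exists N, forall m n, (N <= m)%N -> (N <= n)%N ->
     sq (u_ m - u_ n) < e) ->
  exists l : H, u_ @ \oo --> l.
Proof.
move=> h; suff : cvg (u_ @ \oo) by exists (lim (u_ @ \oo)).
apply: cauchy_cvg; apply/cauchyP => e e0.
have [r r0 ->] := complex_gt0E e0.
have [N hN] := h (r ^+ 2) (exprn_gt0 _ r0).
exists (u_ N); exists N => // n /= Nn.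
by rewrite -ball_normE /= norm_lt_sq// hN.
Qed.

Lemma cvg_ripr (w : H) (u_ : nat -> H) (l : H) : u_ @ \oo --> l ->
  (fun n => rip w (u_ n)) @ \oo --> rip w l.
Proof.
move=> /cvg_sqP ul; apply/cvgrPdist_lt => e e0.
have w1 : 0 < sq w + 1 by rewrite ltr_wpDl// sq_ge0.
move/cvgrPdist_lt : ul => /(_ (e ^+ 2 / (sq w + 1))).
rewrite divr_gt0 ?exprn_gt0// => /(_ isT); apply: filterS => n.
rewrite sub0r normrN ger0_norm ?sq_ge0// ltr_pdivlMr// => h.
rewrite -(@ltr_pXn2r _ 2%N)// ?nnegrE// ?ltW// real_normK ?num_real//.
rewrite -ripBr; apply: le_lt_trans (rip_cauchy_schwarz _ _) _.
rewrite -opprB sqN; apply: le_lt_trans h; rewrite mulrC.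
by rewrite ler_wpM2l ?sq_ge0// lerDl.
Qed.

Lemma cvg_sq (u_ : nat -> H) (l : H) : u_ @ \oo --> l ->
  (fun n => sq (u_ n)) @ \oo --> sq l.
Proof.
move=> ul; have -> : sq l = 0 + 2 * rip l l - sq l by rewrite /sq; ring.
have -> : (fun n => sq (u_ n)) =
    (fun n => sq (u_ n - l) + 2 * rip l (u_ n) - sq l).
  by apply/funext => n; rewrite sqB (ripC l); ring.
apply: cvgB; last exact: cvg_cst.
apply: cvgD; first exact/cvg_sqP.
by apply: cvgMr; exact: cvg_ripr.
Qed.

(** Polarization reduces joint continuity to continuity of the squared norm. *)
Lemma cvg_rip (u_ v_ : nat -> H) (u v : H) :
  u_ @ \oo --> u -> v_ @ \oo --> v ->
  (fun n => rip (u_ n) (v_ n)) @ \oo --> rip u v.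
Proof.
move=> ul vl; have E x y : rip x y = 2^-1 * (sq x + sq y - sq (x - y)).
  by rewrite sqB; field.
rewrite E; under eq_fun do rewrite E.
apply: cvgMr; apply: cvgB; first by apply: cvgD; exact: cvg_sq.
by apply: cvg_sq; exact: cvgB.
Qed.

Lemma orthogonal_closed (w : H) (v_ : nat -> H) (l : H) :
  (forall n, ip (v_ n) w = 0) -> v_ @ \oo --> l -> ip l w = 0.
Proof.
move=> h vl; apply: ip_eq0_rip => a.
have h1 : (fun n => rip (a *: w) (v_ n)) @ \oo --> rip (a *: w) l.
  exact: cvg_ripr.
have h2 : (fun n => rip (a *: w) (v_ n)) @ \oo --> (0 : R).
  have -> : (fun n => rip (a *: w) (v_ n)) = (fun=> 0).
    by apply/funext => n; rewrite /rip ipZl ipC h conjc0 mulr0.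
  exact: cvg_cst.
by rewrite ripC; exact: cvg_unique h1 h2.
Qed.

Lemma cvg_real_complex (f : nat -> R) (l : R) : f @ \oo --> l ->
  (fun n => (f n)%:C%C : R[i]^o) @ \oo --> (l%:C%C : R[i]^o).
Proof.
move=> /cvgrPdist_lt h; apply/cvgrPdist_lt => e e0.
have [r r0 ->] := complex_gt0E e0; apply: filterS (h r r0) => n hn.
by rewrite -rmorphB normc_def /= expr0n addr0 sqrtr_sqr ltcR.
Qed.

Lemma cvg_complex_Re (f : nat -> R[i]) (l : R[i]) :
  (fun n => f n : R[i]^o) @ \oo --> (l : R[i]^o) ->
  (fun n => complex.Re (f n)) @ \oo --> complex.Re l.
Proof.
move=> /cvgrPdist_lt h; apply/cvgrPdist_lt => e e0.
have := h e%:C%C; rewrite ltcR => /(_ e0); apply: filterS => n hn.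
rewrite -ltcR; apply: le_lt_trans hn.
by apply: le_trans (normc_ge_Re _); case: (f n) (l) => [? ?] [].
Qed.

(** * Orthogonal projection *)

(** Closedness is stated with sequences, which determine the topology of a normed
space. *)
Definition closed_subspace (E : set H) := [/\ E 0,
  forall (a : R[i]) u v, E u -> E v -> E (a *: u + v) &
  forall (u_ : nat -> H) (l : H),
    (forall n, E (u_ n)) -> u_ @ \oo --> l -> E l].

(** Points [r n] of [E] whose distance to [f] is almost minimal are almost
projections: minimality along the line [r n + t w] bounds [rip (f - r n) w] by
the discriminant inequality.  Taking [w = r m - r n] shows that [r] is a Cauchy
sequence, and the same bound passes to the limit as exact orthogonality. *)
Lemma orthogonal_projection (E : set H) (f : H) : closed_subspace E ->
  exists2 r, E r & forall w, E w -> rip (f - r) w = 0.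
Proof.
move=> [E0 Elin Eclosed]; pose D := [set sq (f - r) | r in E].
have Dinf : has_inf D.
  split; first by exists (sq (f - 0)), 0.
  by exists 0 => _ [r _ <-]; exact: sq_ge0.
pose d := inf D.
have dle r : E r -> d <= sq (f - r).
  by move=> Er; apply: ge_inf; [exact: Dinf.2|exists r].
have /choice [r_ r_P] : forall n : nat, exists r,
    E r /\ sq (f - r) < d + harmonic n.
  move=> n; have [_ [r Er <-] h] := inf_adherent (harmonic_gt0 n) Dinf.
  by exists r.
have rE n : E (r_ n) := (r_P n).1.
have key n w : E w -> rip (f - r_ n) w ^+ 2 <= harmonic n * sq w.
  move=> Ew; apply: (@le_trans _ _ ((sq (f - r_ n) - d) * sq w)); last first.
    by rewrite ler_wpM2r ?sq_ge0// lerBlDl ltW// (r_P n).2.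
  apply: discriminant_le => [|t]; first exact: sq_ge0.
  have := dle _ (Elin (- t%:C%C) w (r_ n) Ew (rE n)).
  have -> : f - (- t%:C%C *: w + r_ n) = (f - r_ n) + t%:C%C *: w.
    by rewrite opprD scaleNr opprK addrCA addrC.
  by rewrite sqD sqZ ripZr; lra.
(* The difference w satisfies sq w = rip (f - r n) w - rip (f - r m) w. *)
have close m n : sq (r_ m - r_ n) <= 2 * (harmonic m + harmonic n).
  set w := r_ m - r_ n.
  have Ew : E w by rewrite /w addrC -scaleN1r; exact: Elin.
  have [w0|w0] := eqVneq (sq w) 0.
    by rewrite w0 mulr_ge0// addr_ge0// harmonic_ge0.
  have wp : 0 < sq w by rewrite lt_neqAle eq_sym w0 sq_ge0.
  have := key m w Ew; have := key n w Ew.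
  have -> : rip (f - r_ n) w = sq w + rip (f - r_ m) w.
    have -> : f - r_ n = w + (f - r_ m) 
      by rewrite /w (addrC (r_ m - _)) addrA subrK.
    by rewrite ripDl.
  set x := rip _ w => h1 h2.
  rewrite -(ler_pM2r wp); have := sqr_ge0 (sq w + 2 * x).
  by move: (harmonic n) (harmonic m) h1 h2 => a b; lra.
have [l rl] : exists l : H, r_ @ \oo --> l.
  apply: sq_complete => e e0.
  have /cvgrPdist_lt/(_ (e / 4)) := @cvg_harmonic R.
  rewrite divr_gt0// => /(_ isT)[N _ hN].
  have small n : (N <= n)%N -> harmonic n < e / 4.
    by move=> /hN /=; rewrite sub0r normrN ger0_norm ?harmonic_ge0.
  exists N => m n /small hm /small hn.
  apply: le_lt_trans (close m n) _; lra.
exists l; first exact: Eclosed rl.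
move=> w Ew; apply/eqP; rewrite -sqrf_eq0 eq_le sqr_ge0 andbT.
have h1 : (fun n => rip (f - r_ n) w ^+ 2) @ \oo --> rip (f - l) w ^+ 2.
  under eq_fun do rewrite ripBl !(ripC _ w).
  rewrite ripBl !(ripC _ w).
  by apply: cvgM; apply: cvgB; (exact: cvg_cst || exact: cvg_ripr).
have h2 : (fun n => harmonic n * sq w) @ \oo --> 0 * sq w.
  by apply: cvgMl; exact: cvg_harmonic.
rewrite -(mul0r (sq w)); apply: ler_cvg_to h1 h2 _.
by apply: nearW => n; exact: key.
Qed.

(** * Eigenvectors of compact positive operators *)

(** A cluster point of the images, with a rate fixed in advance so that later
limits are comparisons with [harmonic]. *)
Lemma compact_map_subsequence (S : {linear H -> H}) (v_ : nat -> H) :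
  compact_map S -> (forall n, sq (v_ n) = 1) ->
  exists y (n_ : nat -> nat), forall j,
    (j <= n_ j)%N /\ sq (S (v_ (n_ j)) - y) < harmonic j.
Proof.
move=> cS v1; have := cS (range v_); rewrite precompactE.
have bv : bounded_set (range v_).
  have pf : ProperFilter (globally (range v_)).
    by apply: globally_properfilter; exists 0%N.
  apply/ex_bound; exists 2 => _ [n _ <-] /=; apply: ltW.
  have -> : 2 = (2%:R : R)%:C%C :> R[i] by rewrite rmorphMn.
  by rewrite norm_lt_sq// v1; lra.
move=> /(_ bv)/(_ ((S \o v_) @ \oo)) [].
  exists 0%N => // n _ /=; apply: subset_closure; exists (v_ n) => //.
move=> y [_ cy]; exists y.
suff /choice : forall j, exists n,
    (j <= n)%N /\ sq (S (v_ n) - y) < harmonic j.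
  by move=> [n_ n_P]; exists n_.
move=> N; have e0 := @harmonic_gt0 R N; move: (harmonic N) e0 => e e0.
have [] := cy [set S (v_ n) | n in [set n | (N <= n)%N]] (ball y (Num.sqrt e)%:C%C).
- by exists N => // n /= Nn; exists n.
- by apply: nbhsx_ballx; rewrite ltcR sqrtr_gt0.
move=> _ [[n Nn <-]]; rewrite -ball_normE /= norm_lt_sq ?sqrtr_gt0//.
rewrite sqr_sqrtr ?ltW// -opprB sqN => h.
by exists n.
Qed.

(** Let [mu] be the supremum of [rip (S v) v] over the unit vectors of [M].
Cauchy-Schwarz for the form of [S], applied to [v] and [S v], gives
[sq (S v) <= mu * rip (S v) v] on [M], so a maximizing sequence [v n] satisfies
[S (v n) - mu v n -> 0].  Compactness yields a limit [y] of some [S (v n)], and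
[S y = mu y]. *)
Lemma eigenvector_ge_quotient (S : {linear H -> H}) (M : set H) (k : R) u :
  compact_map S ->
  (forall v w, rip (S v) w = rip v (S w)) -> (forall v, 0 <= rip (S v) v) ->
  (forall v, sq (S v) <= sq v) ->
  closed_subspace M -> (forall v, M v -> M (S v)) ->
  M u -> u != 0 -> 0 < k -> k * sq u <= rip (S u) u ->
  exists2 y, M y /\ y != 0 & exists2 mu : R, k <= mu & S y = mu%:C%C *: y.
Proof.
move=> cS Ssym Spos Scontr [M0 Mlin Mclosed] MS Mu u0 k0 ku.
have Mscale (a : R[i]) v : M v -> M (a *: v).
  by move=> Mv; rewrite -[_ *: _]addr0; exact: Mlin.
pose D := [set rip (S v) v | v in [set v | M v /\ sq v = 1]].
(* Unit vectors suffice: the quotient is invariant under scaling. *)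
have normalize v : M v -> v != 0 -> D (rip (S v) v / sq v).
  move=> Mv v0; have vp := sq_gt0 v0.
  have s0 : Num.sqrt (sq v) != 0 by rewrite gt_eqF// sqrtr_gt0.
  exists ((Num.sqrt (sq v))^-1%:C%C *: v).
    split; first exact: Mscale.
    by rewrite sqZ exprVn sqr_sqrtr ?sq_ge0// mulVf ?gt_eqF.
  rewrite linearZ ripZl ripZr mulrA -expr2 exprVn sqr_sqrtr ?sq_ge0//.
  by rewrite mulrC.
have Dsup : has_sup D.
  split; first by eexists; exact: (normalize u).
  exists 1 => _ [v [Mv v1] <-].
  have := rip_cauchy_schwarz (S v) v; rewrite v1 mulr1.
  by move=> /le_trans/(_ (Scontr v)); rewrite v1 expr_le1.
pose mu := sup D.
have Dle v : M v -> rip (S v) v <= mu * sq v.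
  move=> Mv; have [->|v0] := eqVneq v 0.
    by rewrite linear0 /sq !rip0l mulr0.
  rewrite -ler_pdivrMr ?sq_gt0//; apply: ub_le_sup; first exact: Dsup.2.
  exact: normalize.
have kmu : k <= mu.
  rewrite -(ler_pM2r (sq_gt0 u0)); exact: le_trans ku (Dle u Mu).
have mu0 : 0 < mu := lt_le_trans k0 kmu.
have SS v : M v -> sq (S v) <= mu * rip (S v) v.
  move=> Mv; have := Dle _ (MS _ Mv).
  have : sq (S v) ^+ 2 <= rip (S v) v * rip (S (S v)) (S v).
    apply: discriminant_le => [|t]; first exact: Spos.
    have := Spos (v + t%:C%C *: S v).
    rewrite linearD linearZ !(ripDl, ripDr, ripZl, ripZr) (Ssym (S v) v).
    by rewrite -/(sq _); lra.
  have [-> _ _|x0] := eqVneq (sq (S v)) 0; first by rewrite mulr_ge0// ltW.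
  have xp : 0 < sq (S v) by rewrite lt_neqAle eq_sym x0 sq_ge0.
  have := Spos v; move: (rip (S v) v) (sq (S v)) (rip _ _) xp => p x q xp p0 h q_.
  rewrite -(ler_pM2r xp) -expr2; apply: le_trans h _.
  by rewrite (mulrC mu) -mulrA ler_wpM2l.
have /choice[v_ v_P] : forall n : nat, exists v,
    [/\ M v, sq v = 1 & mu - harmonic n < rip (S v) v].
  move=> n; have [_ [v [Mv v1] <-] h] := sup_adherent (harmonic_gt0 n) Dsup.
  by exists v.
have v1 n : sq (v_ n) = 1 by have [] := v_P n.
have approx n : sq (S (v_ n) - mu%:C%C *: v_ n) <= mu * harmonic n.
  have [Mv _ h] := v_P n; rewrite sqB sqZ ripZr v1.
  have := SS _ Mv; have := ler_wpM2l (ltW mu0) (ltW h).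
  by move: (harmonic n) (sq _) (rip _ _) => x p q; lra.
have [y [n_ n_P]] := compact_map_subsequence cS v1.
pose z j := S (v_ (n_ j)).
have zy j : sq (z j - y) < harmonic j by have [] := n_P j.
have zv j : sq (z j - mu%:C%C *: v_ (n_ j)) <= mu * harmonic j.
  apply: le_trans (approx _) _; rewrite ler_pM2l// lef_pV2 ?posrE// ler_nat ltnS.
  by have [] := n_P j.
exists y; first split.
- apply: (Mclosed z); last exact: cvg_sq_harmonic.
  by move=> j; apply: MS; have [] := v_P (n_ j).
- apply/eqP => y0; have : mu ^+ 2 <= 0; last by rewrite leNgt exprn_gt0.
  apply: (@le0_harmonic _ _ (2 * (1 + mu))) => j.
  have -> : mu ^+ 2 = sq (mu%:C%C *: v_ (n_ j)) by rewrite sqZ v1 mulr1.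
  rewrite -[_ *: _](subKr (z j)); apply: le_trans (sqB_le _ _) _.
  by have := zy j; have := zv j; rewrite y0 subr0; lra.
exists mu => //; apply/eqP; rewrite -subr_eq0; apply/eqP/sq_eq0/eqP.
rewrite eq_le sq_ge0 andbT.
apply: (@le0_harmonic _ _ (4 * (1 + mu + mu ^+ 2))) => j.
set p := z j - mu%:C%C *: v_ (n_ j) in zv *; set q := z j - y in zy *.
have -> : S y - mu%:C%C *: y = S p - S q - - (mu%:C%C *: q).
  have -> : S p = S (z j) - mu%:C%C *: z j by rewrite linearB linearZ.
  have -> : S q = S (z j) - S y by rewrite linearB.
  rewrite opprK scalerBr opprB; move: (S (z j)) => s.
  by rewrite [_ - _ + (_ - _)]addrC subrKA subrKA.
apply: le_trans (sqB_le _ _) _; rewrite sqN sqZ.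
have := sqB_le (S p) (S q).
have pj : sq p <= mu * harmonic j := zv j.
have qj : sq q < harmonic j := zy j.
have := Scontr p; have := Scontr q.
have := ler_wpM2l (sqr_ge0 mu) (ltW qj).
have : 0 <= mu ^+ 2 * harmonic j by rewrite mulr_ge0 ?sqr_ge0 ?harmonic_ge0.
by move: (harmonic j) pj qj => h; lra.
Qed.

Section PositiveOperator.
Variable T : operator H.
Hypotheses (Tsa : self_adjoint ip T) (Tnn : nonnegative ip T).

(** * Self-adjoint nonnegative operators *)

Lemma op0 : T 0 = 0.
Proof.
have := op_linear 1 (op_dom0 T) (op_dom0 T).
by rewrite !scale1r addr0 => /eqP; rewrite -subr_eq0 opprD addrA subrr sub0r oppr_eq0 => /eqP.
Qed.

Lemma dom_scale a u : op_dom T u -> op_dom T (a *: u).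
Proof. by move=> du; rewrite -[_ *: _]addr0; apply: op_domP => //; exact: op_dom0. Qed.

Lemma opZ a u : op_dom T u -> T (a *: u) = a *: T u.
Proof.
move=> du; rewrite -[in LHS](addr0 (a *: u)) op_linear ?op0 ?addr0//.
exact: op_dom0.
Qed.

Lemma dom_sub u v : op_dom T u -> op_dom T v -> op_dom T (u - v).
Proof. by move=> du dv; rewrite addrC -scaleN1r; exact: op_domP. Qed.

Lemma opB u v : op_dom T u -> op_dom T v -> T (u - v) = T u - T v.
Proof. by move=> du dv; rewrite addrC -scaleN1r op_linear// scaleN1r addrC. Qed.

Lemma dom_sum (I : finType) (c : I -> R[i]) (e : I -> H) :
  (forall i, op_dom T (e i)) -> op_dom T (\sum_i c i *: e i).
Proof.
move=> de; elim/big_ind : _ => [|u v du dv|i _]; first exact: op_dom0.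
  by rewrite -(scale1r u); exact: op_domP.
exact: dom_scale.
Qed.

Lemma op_sum (I : finType) (c : I -> R[i]) (e : I -> H) :
  (forall i, op_dom T (e i)) -> T (\sum_i c i *: e i) = \sum_i c i *: T (e i).
Proof.
move=> de; suff [] : op_dom T (\sum_i c i *: e i) /\
    T (\sum_i c i *: e i) = \sum_i c i *: T (e i) by [].
elim/big_ind2 : _ => [|u u' v v' [du <-] [dv <-]|i _].
- by split; [exact: op_dom0|exact: op0].
- rewrite -(scale1r u'); split; first exact: op_domP.
  by rewrite op_linear// !scale1r.
- by split; [exact: dom_scale|exact: opZ].
Qed.

Lemma op_symmetric u v : op_dom T u -> op_dom T v -> ip (T u) v = ip u (T v).
Proof.
move=> du dv; have : adjoint_graph ip T (v, T v) by rewrite Tsa.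
exact.
Qed.

(** The domain is a complex subspace, so testing against [u] and ['i *: u] recovers
the full inner product from its real part. *)
Lemma self_adjoint_rip p q :
  (forall u, op_dom T u -> rip (T u) p = rip u q) -> op_dom T p /\ T p = q.
Proof.
move=> h; have : adjoint_graph ip T (p, q).
  move=> u du /=; apply/eqP; rewrite eq_complex; apply/andP; split; apply/eqP.
    exact: h.
  by apply: oppr_inj; rewrite -!ripil -h ?opZ//; exact: dom_scale.
by rewrite Tsa => -[].
Qed.

(** * The form inner product *)

(** The real part of [form_ip]; by nonnegativity it dominates the inner product
of [H]. *)
Definition fform u v := rip u v + rip (T u) v.

Lemma fformC u v : op_dom T u -> op_dom T v -> fform u v = fform v u.
Proof. move=> du dv; rewrite /fform (ripC u v); congr (_ + _).
by rewrite (ripC (T v)) /rip op_symmetric. Qed.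

Lemma fform_ge_sq u : op_dom T u -> sq u <= fform u u.
Proof.
by move=> du; rewrite /fform lerDl; have := Tnn du; rewrite lecE => /andP[].
Qed.

Lemma fform_ge0 u : op_dom T u -> 0 <= fform u u.
Proof. by move=> du; apply: le_trans (fform_ge_sq du); exact: sq_ge0. Qed.

Lemma fformDr u v w : fform u (v + w) = fform u v + fform u w.
Proof. by rewrite /fform !ripDr addrACA. Qed.

Lemma fformZr a u v : fform u (a%:C%C *: v) = a * fform u v.
Proof. by rewrite /fform !ripZr mulrDr. Qed.

Lemma fform_linl a u v w : op_dom T u -> op_dom T v ->
  fform (a%:C%C *: u + v) w = a * fform u w + fform v w.
Proof. by move=> du dv; rewrite /fform op_linear// !(ripDl, ripZl); ring. Qed.

Lemma fform_lin a u v : op_dom T u -> op_dom T v ->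
  fform (a%:C%C *: u + v) (a%:C%C *: u + v) =
  a ^+ 2 * fform u u + 2 * a * fform u v + fform v v.
Proof.
by move=> du dv; rewrite fform_linl// !fformDr !fformZr (fformC dv du); ring.
Qed.

Lemma fform_sub u v : op_dom T u -> op_dom T v ->
  fform (u - v) (u - v) = fform u u - 2 * fform u v + fform v v.
Proof.
move=> du dv; have -> : u - v = (-1)%:C%C *: v + u.
  by rewrite rmorphN scaleN1r addrC.
by rewrite fform_lin// (fformC dv du); ring.
Qed.

Lemma fform_sub_le u v : op_dom T u -> op_dom T v ->
  fform (u - v) (u - v) <= 2 * (fform u u + fform v v).
Proof.
move=> du dv; rewrite fform_sub//.
have := fform_ge0 (op_domP 1%:C%C du dv); rewrite fform_lin//; lra.
Qed.

Lemma fform_cauchy_schwarz u v : op_dom T u -> op_dom T v ->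
  fform u v ^+ 2 <= fform u u * fform v v.
Proof.
move=> du dv; apply: discriminant_le => [|t]; first exact: fform_ge0.
have := fform_ge0 (op_domP t%:C%C dv du).
by rewrite fform_lin// (fformC dv du); lra.
Qed.

(** * The resolvent at -1 *)

(** [T + 1] does not decrease norms: its inverse is a contraction. *)
Lemma sq_le_shift u : op_dom T u -> sq u <= sq (T u + u).
Proof.
move=> du; have h := fform_ge_sq du.
have := rip_cauchy_schwarz (T u + u) u.
have -> : rip (T u + u) u = fform u u by rewrite /fform ripDl addrC.
have [-> _|u0] := eqVneq (sq u) 0; first exact: sq_ge0.
have up : 0 < sq u by rewrite lt_neqAle eq_sym u0 sq_ge0.
by move=> h2; rewrite -(ler_pM2r up); nra.
Qed.

(** The preimages form a Cauchy sequence by [sq_le_shift], and their limit is in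
the domain because a self-adjoint operator has a closed graph. *)
Lemma shift_range_closed (u_ : nat -> H) (l : H) : (forall n, op_dom T (u_ n)) ->
  (fun n => T (u_ n) + u_ n) @ \oo --> l -> exists2 u, op_dom T u & T u + u = l.
Proof.
move=> du rl; have [u ul] : exists u : H, u_ @ \oo --> u.
  apply: sq_complete => e /(cvg_sq_cauchy rl)[N hN].
  exists N => m n Nm Nn; apply: le_lt_trans (hN m n Nm Nn).
  apply: le_trans (sq_le_shift (dom_sub (du m) (du n))) _.
  by rewrite opB// opprD addrACA.
have [dou Tu] : op_dom T u /\ T u = l - u.
  apply: self_adjoint_rip => v dv; rewrite ripBr.
  have h1 : (fun n => rip (T v) (u_ n)) @ \oo --> rip (T v) u by exact: cvg_ripr.
  have h2 : (fun n => rip v (T (u_ n) + u_ n) - rip v (u_ n)) @ \oo -->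
      rip v l - rip v u.
    by apply: cvgB; exact: cvg_ripr.
  apply: cvg_unique h1 _ => //; apply: cvg_trans h2; apply: near_eq_cvg.
  apply: nearW => n; rewrite -ripBr addrK; apply/eqP.
  by rewrite /rip op_symmetric.
by exists u => //; rewrite Tu subrK.
Qed.

(** The range of [T + 1] is closed.  A vector [w] orthogonal to it satisfies
[T w = - w] by self-adjointness, which contradicts nonnegativity unless
[w = 0]. *)
Lemma shift_onto f : exists2 u, op_dom T u & T u + u = f.
Proof.
pose E := [set T u + u | u in op_dom T].
have E0 : E 0 by exists 0; [exact: op_dom0|rewrite op0 addr0].
have Elin (a : R[i]) u v : E u -> E v -> E (a *: u + v).
  move=> [u' du <-] [v' dv <-]; exists (a *: u' + v'); first exact: op_domP.
  by rewrite op_linear// scalerDr addrACA.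
have Eclosed (r_ : nat -> H) (l : H) :
    (forall n, E (r_ n)) -> r_ @ \oo --> l -> E l.
  move=> rE rl.
  have /choice[u_ u_P] : forall n, exists v, op_dom T v /\ T v + v = r_ n.
    by move=> n; have [v dv <-] := rE n; exists v.
  have [||v dv <-] := @shift_range_closed u_ l; last by exists v.
    by move=> n; have [] := u_P n.
  by under eq_fun do rewrite (u_P _).2.
have [r Er orth] := orthogonal_projection f (And3 E0 Elin Eclosed).
have [dw Tw] : op_dom T (f - r) /\ T (f - r) = - (f - r).
  apply: self_adjoint_rip => u du; rewrite ripNr; apply/eqP.
  rewrite -addr_eq0 -ripDl ripC; apply/eqP/orth.
  by exists u.
have : f - r = 0.
  apply: sq_eq0; apply/eqP; rewrite eq_le sq_ge0 andbT.
  have := fform_ge_sq dw; rewrite /fform Tw ripNl -/(sq _); lra.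
by move=> /eqP; rewrite subr_eq0 => /eqP fr; rewrite fr.
Qed.

Lemma shift_inj u v : op_dom T u -> op_dom T v -> T u + u = T v + v -> u = v.
Proof.
move=> du dv e; apply/eqP; rewrite -subr_eq0; apply/eqP/sq_eq0/eqP.
rewrite eq_le sq_ge0 andbT; apply: le_trans (sq_le_shift (dom_sub du dv)) _.
by rewrite opB// addrACA -opprD e subrr /sq rip0l.
Qed.

Lemma resolvent_exists : exists S : {linear H -> H},
  [/\ is_resolvent T (-1) S, forall v, op_dom T (S v) &
      forall v, T (S v) + S v = v].
Proof.
have /choice[S0 S0P] : forall v, exists u, op_dom T u /\ T u + u = v.
  by move=> v; have [u du <-] := shift_onto v; exists u.
have dS v : op_dom T (S0 v) by have [] := S0P v.
have TS v : T (S0 v) + S0 v = v by have [] := S0P v.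
have S0lin : linear S0.
  move=> a u v; apply: shift_inj => //; first exact: op_domP.
  by rewrite TS op_linear// addrACA -scalerDr !TS.
pose S : {linear H -> H} := HB.pack S0 (GRing.isLinear.Build _ _ _ _ S0 S0lin).
exists S; split => //; split.
- apply: bounded_linear_continuous; apply/ex_bound; exists 1.
  apply/nbhs_ballP; exists 1 => //= v; rewrite -ball_normE /= sub0r normrN.
  rewrite (@norm_lt_sq _ 1)// => v1.
  apply: ltW; rewrite (@norm_lt_sq _ 1)//; apply: le_lt_trans v1.
  by rewrite -{2}(TS v); exact: sq_le_shift.
- by move=> v; split => //; rewrite scaleN1r opprK; exact: TS.
- by move=> u du; rewrite scaleN1r opprK; exact: shift_inj.
Qed.

(** * The quadratic form on its domain *)

Definition fcauchy (u_ : nat -> H) := (forall n, op_dom T (u_ n)) /\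
  forall e, 0 < e -> exists N, forall m n, (N <= m)%N -> (N <= n)%N ->
    fform (u_ m - u_ n) (u_ m - u_ n) < e.

Lemma form_cauchy_fcauchy u_ : form_cauchy ip T u_ -> fcauchy u_.
Proof.
move=> [du h]; split => // e e0.
have [|N hN] := h e%:C%C; first by rewrite ltcR.
exists N => m n Nm Nn; have := hN m n Nm Nn.
rewrite /form_ip ltcE => /andP[_]; rewrite /fform /rip.
by case: (ip _ _) (ip _ _) => [? ?] [].
Qed.

Lemma fcauchy_sub u_ v_ : fcauchy u_ -> fcauchy v_ ->
  fcauchy (fun n => u_ n - v_ n).
Proof.
move=> [du hu] [dv hv]; split=> [n|e e0]; first exact: dom_sub.
have [N1 h1] := hu _ (divr_gt0 e0 (ltr0n _ 4)).
have [N2 h2] := hv _ (divr_gt0 e0 (ltr0n _ 4)).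
exists (maxn N1 N2) => m n; rewrite !geq_max => /andP[m1 m2] /andP[n1 n2].
have -> : u_ m - v_ m - (u_ n - v_ n) = (u_ m - u_ n) - (v_ m - v_ n).
  by rewrite !opprD addrACA.
apply: le_lt_trans (fform_sub_le (dom_sub _ _) (dom_sub _ _)) _ => //.
by have := h1 m n m1 n1; have := h2 m n m2 n2; lra.
Qed.

(** For fixed [n], [fform (w n) (w m) = rip ((T + 1) (w n)) (w m)] tends to [0]
with [m], since [w n] is in the domain; so [fform (w n) (w n)] is bounded by the
limit of [fform (w n - w m) (w n - w m)], which the Cauchy condition makes
small. *)
Lemma form_closable w_ : fcauchy w_ -> w_ @ \oo --> (0 : H) ->
  (fun n => fform (w_ n) (w_ n)) @ \oo --> 0.
Proof.
move=> [dw hw] w0; apply/cvgrPdist_lt => e e0.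
have [N hN] := hw _ (divr_gt0 e0 (ltr0n _ 2)).
exists N => // n /= Nn; rewrite sub0r normrN ger0_norm ?fform_ge0//.
suff : fform (w_ n) (w_ n) <= e / 2 by lra.
have h1 : (fun=> fform (w_ n) (w_ n)) @ \oo --> fform (w_ n) (w_ n).
  exact: cvg_cst.
have h2 : (fun m => e / 2 + 2 * rip (w_ n + T (w_ n)) (w_ m)) @ \oo --> e / 2.
  have {2}-> : e / 2 = e / 2 + 2 * rip (w_ n + T (w_ n)) 0.
    by rewrite ripC rip0l mulr0 addr0.
  by apply: cvgD; [exact: cvg_cst|apply: cvgMr; exact: cvg_ripr].
apply: ler_cvg_to h1 h2 _; exists N => // m /= Nm.
have := hN n m Nn Nm; rewrite fform_sub// ripDl -/(fform _ _).
have := fform_ge0 (dw m); lra.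
Qed.

(** By Cauchy-Schwarz the form norms satisfy the reverse triangle inequality, so
they form a Cauchy sequence of reals. *)
Lemma cvg_fform_fcauchy u_ : fcauchy u_ ->
  exists b : R, (fun n => fform (u_ n) (u_ n)) @ \oo --> b.
Proof.
move=> [du hu]; pose g n := Num.sqrt (fform (u_ n) (u_ n)).
have gg n : g n * g n = fform (u_ n) (u_ n).
  by rewrite -expr2 sqr_sqrtr ?fform_ge0.
suff gc : cvg (g @ \oo).
  exists (lim (g @ \oo) * lim (g @ \oo)).
  by under eq_fun do rewrite -gg; apply: cvgM.
apply: cauchy_cvg; apply/cauchyP => e e0.
have [N hN] := hu _ (exprn_gt0 2 e0).
exists (g N); exists N => // n /= Nn; rewrite -ball_normE /=.
rewrite -(@ltr_pXn2r _ 2%N)// ?nnegrE// ?ltW// real_normK ?num_real//.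
apply: le_lt_trans (hN N n (leqnn N) Nn).
rewrite fform_sub// -!gg.
have : fform (u_ N) (u_ n) <= g N * g n.
  apply: le_trans (ler_norm _) _; rewrite -sqrtr_sqr.
  by rewrite /g -sqrtrM ?fform_ge0// ler_wsqrtr// fform_cauchy_schwarz.
lra.
Qed.

(** The existence part of [cvg_fform_fcauchy] rules out the default value in
the definition of [qform]. *)
Lemma qform_limit u : form_domain ip T u -> exists u_ v_ : nat -> H,
  [/\ fcauchy u_, fcauchy v_, u_ @ \oo --> u, v_ @ \oo --> u &
      (fun n => fform (u_ n) (v_ n)) @ \oo --> complex.Re (qform ip T u u) + sq u].
Proof.
move=> [u_ ru]; have [cu ul] := ru.
have fu := form_cauchy_fcauchy cu.
have [b bl] := cvg_fform_fcauchy fu.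
have := @xgetPex _ 0 [set c : R[i] | exists u_ v_ : nat -> H,
    [/\ form_represents ip T u_ u, form_represents ip T v_ u &
        (fun n => ip (T (u_ n)) (v_ n) : R[i]^o) @ \oo --> (c : R[i]^o)]].
case.
  exists (b - sq u)%:C%C, u_, u_; split => //.
  have -> : (fun n => ip (T (u_ n)) (u_ n)) =
      (fun n => (fform (u_ n) (u_ n) - sq (u_ n))%:C%C).
    apply/funext => n; rewrite /fform addrAC subrr add0r.
    have := Tnn (fu.1 n); rewrite lecE /= => /andP[/eqP].
    by rewrite /rip; case: (ip _ _) => x y /= ->.
  by apply: cvg_real_complex; apply: cvgB => //; exact: cvg_sq.
rewrite -/(qform ip T u u) => u1 [v1 [[c1 l1] [c2 l2] h]].
exists u1, v1; split => //; try exact: form_cauchy_fcauchy.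
rewrite addrC; apply: cvgD; last exact: cvg_complex_Re.
exact: cvg_rip.
Qed.

(** Both representing sequences differ from [u] by null sequences of the form norm. *)
Lemma qform_le_op u : op_dom T u ->
  form_domain ip T u /\ complex.Re (qform ip T u u) <= rip (T u) u.
Proof.
move=> du; have Vu : form_domain ip T u.
  exists (fun=> u); split; last exact: cvg_cst.
  split=> // e e0; exists 0%N => m n _ _.
  by rewrite /form_ip subrr op0 !linear0r addr0.
split => //; have [u_ [v_ [fu fv ul vl h]]] := qform_limit Vu.
have fc : fcauchy (fun=> u).
  by split => // e e0; exists 0%N => m n _ _; rewrite subrr /fform op0 !rip0l addr0.
have null w_ : fcauchy w_ -> w_ @ \oo --> u ->
    (fun n => fform (w_ n - u) (w_ n - u)) @ \oo --> 0.
  move=> fw wl; apply: (form_closable (fcauchy_sub fw fc)).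
  by rewrite -[X in _ --> X](subrr u); apply: cvgB => //; exact: cvg_cst.
have lin w_ : w_ @ \oo --> u -> (fun n => fform u (w_ n)) @ \oo --> fform u u.
  rewrite /fform -ripDl => wl.
  by under eq_fun do rewrite -ripDl; exact: cvg_ripr.
suff : complex.Re (qform ip T u u) + sq u <= fform u u by rewrite /fform; lra.
(* With p = u n - u and q = v n - u, the value at (u n, v n) is that of (p, q)
   plus terms of known limit, and fform p q <= (fform p p + fform q q) / 2. *)
have {}h2 : (fun n => 2^-1 * (fform (u_ n - u) (u_ n - u) + fform (v_ n - u) (v_ n - u))
     + fform u (u_ n) + fform u (v_ n) - fform u u) @ \oo -->
   2^-1 * (0 + 0) + fform u u + fform u u - fform u u.
  apply: cvgB; last exact: cvg_cst.
  apply: cvgD; last exact: lin.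
  apply: cvgD; last exact: lin.
  by apply: cvgMr; apply: cvgD; exact: null.
have -> : fform u u = 2^-1 * (0 + 0) + fform u u + fform u u - fform u u by ring.
apply: ler_cvg_to h h2 _; apply: nearW => n /=.
have [dun dvn] : op_dom T (u_ n) /\ op_dom T (v_ n) by split; [exact: fu.1|exact: fv.1].
have := fform_ge0 (dom_sub dun dvn).
rewrite !fform_sub// (fformC dun du) (fformC dvn du).
have := @fform_sub (u_ n - u) (v_ n - u) (dom_sub dun du) (dom_sub dvn du).
lra.
Qed.

(** With [s = (T + 1)^-1 u] one has [rip u w = fform s w] for all [w], so this is the
Cauchy-Schwarz inequality of the form for [s] and [u].  It is applied to
[u n + v n], which represents [2 u]; by polarization and closability,
[4 fform (u n) (v n)] has the same limit as
[fform (u n + v n) (u n + v n)]. *)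
Lemma sq_le_resolvent_qform u s : form_domain ip T u -> op_dom T s -> T s + s = u ->
  sq u ^+ 2 <= rip s u * (complex.Re (qform ip T u u) + sq u).
Proof.
move=> Vu ds su; have [u_ [v_ [fu fv ul vl h]]] := qform_limit Vu.
have bs w : fform s w = rip u w by rewrite /fform -ripDl addrC su.
have null : (fun n => fform (u_ n - v_ n) (u_ n - v_ n)) @ \oo --> 0.
  apply: (form_closable (fcauchy_sub fu fv)).
  by rewrite -[X in _ --> X](subrr u); apply: cvgB.
have h1 : (fun n => (rip u (u_ n) + rip u (v_ n)) * (rip u (u_ n) + rip u (v_ n)))
    @ \oo --> (sq u + sq u) * (sq u + sq u).
  by apply: cvgM; apply: cvgD; exact: cvg_ripr.
have h2 : (fun n => rip s u * (4 * fform (u_ n) (v_ n) + fform (u_ n - v_ n) (u_ n - v_ n)))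
   @ \oo --> rip s u * (4 * (complex.Re (qform ip T u u) + sq u) + 0).
  by apply: cvgMr; apply: cvgD => //; exact: cvgMr.
suff : (sq u + sq u) * (sq u + sq u) <=
  rip s u * (4 * (complex.Re (qform ip T u u) + sq u) + 0) by lra.
apply: ler_cvg_to h1 h2 _; apply: nearW => n /=.
have [dun dvn] : op_dom T (u_ n) /\ op_dom T (v_ n) by split; [exact: fu.1|exact: fv.1].
rewrite -!bs -fformDr -expr2.
have := fform_cauchy_schwarz ds (op_domP 1%:C%C dun dvn).
rewrite fform_sub// fform_lin// scale1r bs -ripC.
by move=> h3; apply: le_trans h3 _; rewrite ripC -bs bs; lra.
Qed.

(** * Orthogonal eigenvectors from bounds on the form *)

Lemma eigenvalue_ge0 (a : R) u : op_dom T u -> T u = a%:C%C *: u -> u != 0 -> 0 <= a.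
Proof.
move=> du Tu u0; have := fform_ge_sq du.
by rewrite /fform Tu ripZl lerDl pmulr_lge0// sq_gt0.
Qed.

(** The bound on the form at [u] becomes [(x + 1)^-1 * sq u <= rip (S u) u] for the
resolvent [S] at -1, and [S] preserves the orthogonal complement of the [v i]; an
eigenvector of [S] for [mu] is one of [T] for [mu^-1 - 1]. *)
Lemma orthogonal_eigenvector (k : nat) (v : nat -> H) (a : nat -> R) (x : R) u :
  compactly_resolved T ->
  (forall i, (i < k)%N -> [/\ op_dom T (v i), T (v i) = (a i)%:C%C *: v i & v i != 0]) ->
  form_domain ip T u -> u != 0 -> (forall i, (i < k)%N -> ip u (v i) = 0) ->
  complex.Re (qform ip T u u) <= x * sq u ->
  exists y b, [/\ op_dom T y, T y = b%:C%C *: y, y != 0, b <= x &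
    forall i, (i < k)%N -> ip y (v i) = 0].
Proof.
move=> Tcr vP Vu u0 uv ux.
have [S [resS dS TS]] := resolvent_exists.
have Sb v1 w : rip v1 (S w) = fform (S v1) (S w).
  by rewrite -{1}(TS v1) ripDl addrC.
have Ssym v1 w : rip (S v1) w = rip v1 (S w).
  by rewrite ripC !Sb fformC.
have Spos v1 : 0 <= rip (S v1) v1 by rewrite Ssym Sb fform_ge0.
have Scontr v1 : sq (S v1) <= sq v1 by rewrite -{2}(TS v1) sq_le_shift.
pose M := [set w : H | forall i, (i < k)%N -> ip w (v i) = 0].
have MS w : M w -> M (S w).
  move=> Mw i ik; have [dv Tv v0] := vP i ik.
  (* 0 = ip ((T + 1) (S w)) (v i) = (a i + 1) ip (S w) (v i), and a i >= 0. *)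
  have := Mw i ik; rewrite -{1}(TS w) ipDl op_symmetric// Tv ipZr_real.
  move=> /eqP; rewrite -[X in _ + X]mul1r -mulrDl mulf_eq0 => /orP[|/eqP//].
  rewrite eq_complex /= => /andP[/eqP a1 _].
  by have := eigenvalue_ge0 dv Tv v0; rewrite -[a i](addrK 1) a1 sub0r oppr_ge0 ler10.
have up := sq_gt0 u0.
have h : sq u <= rip (S u) u * (x + 1).
  rewrite -(ler_pM2r up); have := sq_le_resolvent_qform Vu (dS u) (TS u).
  by have := Spos u; move: (rip _ _) (complex.Re _) (sq u) ux up => *; nra.
have x1 : 0 < x + 1.
  by rewrite ltNge; apply/negP => x1; have := Spos u; nra.
have [] := @eigenvector_ge_quotient S M (x + 1)^-1 u (Tcr _ _ resS) Ssym Spos Scontr _ MS uv u0.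
- split=> [i ik|c v1 w Mv Mw i ik|v_ l Mv vl i ik]; first exact: linear0l.
    by rewrite ipDl ipZl Mv// Mw// mulr0 addr0.
  by apply: orthogonal_closed vl => n; exact: Mv.
- by rewrite invr_gt0.
- by rewrite mulrC ler_pdivrMr.
move=> y [My y0] [mu xmu Sy].
have mu0 : 0 < mu by apply: lt_le_trans xmu; rewrite invr_gt0.
have muC : mu%:C%C != 0 by rewrite -[0]/(0%:C%C) (inj_eq (@complexI _)) gt_eqF.
have dy : op_dom T y.
  have -> : y = (mu%:C%C)^-1 *: S y by rewrite Sy scalerA mulVf// scale1r.
  exact: dom_scale.
exists y, (mu^-1 - 1); split => //.
  apply: (scalerI muC); rewrite -opZ// -Sy scalerA -rmorphM mulrBr mulr1.
  rewrite divff ?gt_eqF// rmorphB scalerBl scale1r -Sy.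
  by rewrite -[X in X - _](TS y) addrK.
by rewrite lerBlDr -(invrK (x + 1)) lef_pV2 ?posrE// invr_gt0.
Qed.

(** [lin_indep] over an arbitrary finite index type, which lets families in
several eigenspaces be joined over a dependent sum. *)
Definition independent (I : finType) (e : I -> H) :=
  forall c : I -> R[i], \sum_i c i *: e i = 0 -> forall i, c i = 0.

(** Orthogonality to [k] vectors imposes [k] homogeneous linear equations on more
than [k] coefficients. *)
Lemma exists_orthogonal_combination (I : finType) (e : I -> H) (k : nat) (v : nat -> H) :
  independent e -> (k < #|I|)%N ->
  exists c : I -> R[i], \sum_i c i *: e i != 0 /\
    forall j, (j < k)%N -> ip (\sum_i c i *: e i) (v j) = 0.
Proof.
move=> ind kI; pose A := \matrix_(i < #|I|, j < k) ip (e (enum_val i)) (v j).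
have /rowV0Pn[r /sub_kermxP rA r0] : kermx A != 0.
  rewrite -mxrank_eq0 mxrank_ker -lt0n subn_gt0.
  by apply: leq_ltn_trans (rank_leq_col _) kI.
exists (fun i => r 0 (enum_rank i)); split.
  apply: contra r0 => /eqP/ind c0; apply/eqP/rowP => j.
  by rewrite mxE -(c0 (enum_val j)) enum_valK.
move=> j jk; rewrite ip_suml; have /rowP/(_ (Ordinal jk)) := rA.
rewrite !mxE => s0; rewrite -[RHS]s0 (reindex _ (onW_bij _ (@enum_val_bij I))) /=.
by apply: eq_bigr => i _; rewrite mxE enum_valK.
Qed.

(** Indexing by natural numbers, with junk beyond [n], makes it easy to append a
vector. *)
Definition eigenfamily (n : nat) (x : R) (v : nat -> H) (a : nat -> R) :=
  (forall i, (i < n)%N ->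
     [/\ op_dom T (v i), T (v i) = (a i)%:C%C *: v i, v i != 0 & a i <= x]) /\
  (forall i j, (i < j < n)%N -> ip (v j) (v i) = 0).

(** As long as fewer vectors have been found than the dimension of the span, some
nonzero combination of the [e i] is orthogonal to all of them. *)
Lemma eigenfamily_exists (I : finType) (e : I -> H) (x : R) :
  compactly_resolved T -> independent e ->
  (forall c : I -> R[i], let u := \sum_i c i *: e i in
     form_domain ip T u /\ complex.Re (qform ip T u u) <= x * sq u) ->
  exists v a, eigenfamily #|I| x v a.
Proof.
move=> Tcr ind ex; suff : forall n, (n <= #|I|)%N -> exists v a, eigenfamily n x v a.
  exact.
elim=> [_|n IH nI].
  by exists (fun=> 0), (fun=> 0); split => // i j /andP[].
have [v [a [eig orth]]] := IH (ltnW nI).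
have [c [u0 uv]] := exists_orthogonal_combination v ind nI.
have [Vu ux] := ex c.
have [|y [b [dy Ty y0 bx yv]]] := @orthogonal_eigenvector n v a x _ Tcr _ Vu u0 uv ux.
  by move=> i /eig[].
exists (fun i => if (i < n)%N then v i else y), (fun i => if (i < n)%N then a i else b).
split=> [i _|i j /andP[ij]]; first by case: ifP => // /eig.
rewrite ltnS leq_eqVlt => /predU1P[jn|jn].
  by rewrite jn in ij *; rewrite ltnn ij yv.
by rewrite jn (ltn_trans ij jn) orth// ij.
Qed.

(** * The counting function *)

Lemma le_edim (n : nat) (e : 'I_n -> H) (W : set H) :
  (forall i, W (e i)) -> lin_indep e -> (n%:R%:E <= edim R W)%E.
Proof. by move=> We ie; apply: ereal_sup_ubound; exists n => //; exists e. Qed.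

Lemma orthogonal_independent (I : finType) (e : I -> H) :
  (forall i j, i != j -> ip (e i) (e j) = 0) -> (forall i, e i != 0) ->
  independent e.
Proof.
move=> orth nz c s0 i; have := ip_suml c e (e i).
rewrite s0 linear0l (bigD1 i)//= big1 ?addr0 => [|j ji]; last by rewrite orth// mulr0.
move=> /esym/eqP; rewrite mulf_eq0 => /orP[/eqP//|].
by rewrite ip_sq -[0]/(0%:C%C) (inj_eq (@complexI _)) gt_eqF// sq_gt0.
Qed.

(** The vectors are grouped by eigenvalue: those of one group are independent in the
eigenspace, and the group sizes add up to [n]. *)
Lemma eigenfamily_le_counting (n : nat) (x : R) v a :
  eigenfamily n x v a -> (n%:R%:E <= counting_fun T x)%E.
Proof.
move=> [eig orth]; pose z (i : 'I_n) := (a i)%:C%C.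
pose s := undup (codom z).
apply: esum_ge; exists [set` s].
  split; first exact: finite_seq.
  move=> w /=; rewrite mem_undup => /codomP[i ->].
  have [dv Tv v0 ax] := eig i (ltn_ord i); split; last by rewrite lecR.
  by exists (v i).
rewrite -fsbig_seq ?undup_uniq//=.
apply: (@le_trans _ _ (\sum_(w <- s) (#|[pred i | z i == w]|%:R : R)%:E)%E); last first.
  apply: lee_sum => w _; pose e (j : 'I_(#|[pred i | z i == w]|)) := v (enum_val j).
  have zj j : z (@enum_val _ [pred i | z i == w] j) = w.
    by have := enum_valP j; rewrite inE => /eqP.
  apply: (@le_edim _ e).
    move=> j; have [dv Tv _ _] := eig _ (ltn_ord (enum_val j)).
    by split => //; rewrite /e Tv; congr (_ *: _); exact: zj.
  apply: orthogonal_independent => [i j ij|j]; last first.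
    by have [] := eig _ (ltn_ord (enum_val j)).
  have : (enum_val i != enum_val j :> 'I_n) by rewrite (inj_eq enum_val_inj).
  rewrite neq_ltn => /orP[] h; last by rewrite orth// h ltn_ord.
  by rewrite ipC orth ?conjc0// h ltn_ord.
rewrite sumEFin lee_fin -natr_sum ler_nat.
under eq_bigr do rewrite -sum1_card.
rewrite (exchange_big_dep xpredT)//= -{1}(card_ord n) -sum1_card.
apply: leq_sum => i _; rewrite -big_filter sum1_size size_filter.
rewrite -has_count; apply/hasP; exists (z i); last by rewrite inE.
by rewrite mem_undup codom_f.
Qed.

(** Eigenspaces for distinct real eigenvalues are orthogonal, which gives both the
independence of the joined family and
[rip (T u) u = \sum_j b j * sq (w j)], where [w j] is the component of [u] for
the eigenvalue [b j]. *)
Lemma eigenspaces_independent (s : seq R[i]) (m : R[i] -> nat)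
    (e : forall z, 'I_(m z) -> H) (x : R) :
  uniq s -> (forall z, z \in s -> z <= x%:C%C) ->
  (forall z, z \in s -> (forall i, Defs.eigenspace T z (e z i)) /\ lin_indep (@e z)) ->
  exists (I : finType) (f : I -> H), [/\ #|I| = (\sum_(z <- s) m z)%N,
    independent f & forall c : I -> R[i], let u := \sum_i c i *: f i in
      op_dom T u /\ rip (T u) u <= x * sq u].
Proof.
move=> us sx se; pose J := 'I_(size s).
pose I : finType := {j : J & 'I_(m (s`_j))}.
pose tg (j : J) (k : 'I_(m (s`_j))) : I := Tagged (fun j : J => 'I_(m (s`_j))) k.
pose f (i : I) := e _ (tagged i).
pose b (j : J) := complex.Re s`_j.
have sE (j : J) : s`_j = (b j)%:C%C.
  have := sx _ (mem_nth 0 (ltn_ord j)); rewrite lecE /= => /andP[/eqP h _].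
  by rewrite /b; move: h; case: (s`_j) => p q /= <-.
have eigf (i : I) : op_dom T (f i) /\ T (f i) = (b (tag i))%:C%C *: f i.
  by have [/(_ (tagged i)) h _] := se _ (mem_nth 0 (ltn_ord (tag i))); rewrite -sE.
pose w (c : I -> R[i]) (j : J) := \sum_(k < m (s`_j)) c (tg _ k) *: e s`_j k.
have sumE (c : I -> R[i]) : \sum_i c i *: f i = \sum_j w c j.
  by rewrite /w sig_big_dep/=; apply: eq_bigr => -[].
have dw c j : op_dom T (w c j).
  by apply: dom_sum => k; have [] := eigf (tg _ k).
have Tw c j : T (w c j) = (b j)%:C%C *: w c j.
  rewrite op_sum; last by move=> k; have [] := eigf (tg _ k).
  rewrite scaler_sumr; apply: eq_bigr => k _.
  by have [_ /= ->] := eigf (tg _ k); rewrite !scalerA mulrC.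
have orth c j j' : j != j' -> ip (w c j) (w c j') = 0.
  move=> jj; have := op_symmetric (dw c j) (dw c j').
  rewrite !Tw ipZl ipZr_real => /eqP; rewrite -subr_eq0 -mulrBl mulf_eq0 => /orP[|/eqP//].
  rewrite subr_eq0 -!sE nth_uniq// => /eqP jj'.
  by move: jj; rewrite -(inj_eq val_inj) /= jj' eqxx.
exists I, f; split.
- rewrite card_tagged sumnE big_map big_enum /=.
  by rewrite (big_nth 0) big_mkord; apply: eq_bigr => j _; rewrite card_ord.
- move=> c s0 [j k]; rewrite sumE in s0.
  have wj : w c j = 0.
    have [//|wn] := eqVneq (w c j) 0.
    have : ip (\sum_j w c j) (w c j) = ip (w c j) (w c j).
      rewrite linear_sumlz (bigD1 j)//= big1 ?addr0// => j' jj.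
      exact: orth.
    rewrite s0 linear0l ip_sq => /esym/eqP.
    by rewrite -[0]/(0%:C%C) (inj_eq (@complexI _)) gt_eqF// sq_gt0.
  have [_ ie] := se _ (mem_nth 0 (ltn_ord j)).
  exact: (ie (fun k => c (tg _ k)) wj k).
move=> c /=; rewrite sumE; split.
  by rewrite -sumE; apply: dom_sum => i; have [] := eigf i.
have ipw (d : J -> R) : rip (\sum_j (d j)%:C%C *: w c j) (\sum_j w c j) =
    \sum_j d j * sq (w c j).
  rewrite /rip ip_suml; have -> : \sum_j (d j)%:C%C * ip (w c j) (\sum_j w c j) =
      \sum_j (d j * sq (w c j))%:C%C.
    apply: eq_bigr => j _; rewrite linear_sumr (bigD1 j)//= big1 ?addr0.
      by rewrite ip_sq rmorphM.
    by move=> j' jj; apply: orth; rewrite eq_sym.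
  by rewrite -rmorph_sum.
have -> : T (\sum_j w c j) = \sum_j (b j)%:C%C *: w c j.
  have := op_sum (fun=> 1) (dw c).
  under eq_bigr do rewrite scale1r.
  by move=> ->; apply: eq_bigr => j _; rewrite scale1r Tw.
have -> : sq (\sum_j w c j) = \sum_j 1 * sq (w c j).
  rewrite /sq -ipw; congr (rip _ _).
  by apply: eq_bigr => j _; rewrite scale1r.
rewrite ipw mulr_sumr; apply: ler_sum => j _.
rewrite mul1r ler_wpM2r ?sq_ge0// -lecR -sE.
exact/sx/mem_nth.
Qed.

(** A set of natural numbers either has a maximum or is unbounded. *)
Lemma edim_attained_or_unbounded (W : set H) :
  (exists (n : nat) (e : 'I_n -> H),
    [/\ edim R W = n%:R%:E, forall i, W (e i) & lin_indep e]) \/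
  (forall N : nat, exists (n : nat) (e : 'I_n -> H),
    [/\ (N <= n)%N, forall i, W (e i) & lin_indep e]).
Proof.
pose P n := `[< exists e : 'I_n -> H, (forall i, W (e i)) /\ lin_indep e >].
have [[N hN]|unb] := pselect (exists N, forall n, P n -> (n <= N)%N); last first.
  right=> N.
  have /existsNP[n /not_implyP[/asboolP[e [We ie]] /negP nN]] :
    ~ forall n, P n -> (n <= N)%N by move=> h; apply: unb; exists N.
  by exists n, e; split => //; move: nN; rewrite -ltnNge => /ltnW.
left; have exP : exists n, P n.
  by exists 0%N; apply/asboolP; exists (fun=> 0); split => [[]|c _ []].
case: (ex_maxnP exP hN) => n /asboolP[e [We ie]] nmax; exists n, e; split => //.
apply/eqP; rewrite eq_le (le_edim We ie) andbT.
apply: ub_ereal_sup => _ [k [e' he'] <-]; rewrite lee_fin ler_nat.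
by apply: nmax; apply/asboolP; exists e'.
Qed.

(** A finite partial sum of the counting function is either the size of one family
joined from bases of the eigenspaces, or it has an infinite term; then a single
eigenspace contains arbitrarily large families and [N] is infinite. *)
Lemma counting_le_families (x : R) (N : \bar R) :
  (forall (I : finType) (f : I -> H), independent f ->
     (forall c : I -> R[i], let u := \sum_i c i *: f i in
        op_dom T u /\ rip (T u) u <= x * sq u) ->
     (#|I|%:R%:E <= N)%E) ->
  (counting_fun T x <= N)%E.
Proof.
move=> hN.
have fam (s : seq R[i]) (m : R[i] -> nat) (e : forall z, 'I_(m z) -> H) :
    uniq s -> (forall z, z \in s -> z <= x%:C%C) ->
    (forall z, z \in s ->
       (forall i, Defs.eigenspace T z (e z i)) /\ lin_indep (@e z)) ->
    ((\sum_(z <- s) m z)%N%:R%:E <= N)%E.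
  move=> us sx se; have [I [f [<- find fx]]] := eigenspaces_independent us sx se.
  exact: hN find fx.
apply: ub_ereal_sup => _ [X [finX XS] <-].
have [s us Xs] : exists2 s, uniq s & X = [set` s].
  have /finite_seqP[s ->] := finX; exists (undup s); first exact: undup_uniq.
  by apply/seteqP; split => z /=; rewrite mem_undup.
rewrite {}Xs {finX} in XS *; rewrite -fsbig_seq//=.
have sX z : z \in s -> z <= x%:C%C by move=> /XS[].
have [att|] := pselect (forall z, z \in s -> exists n (e : 'I_n -> H),
    [/\ edim R (Defs.eigenspace T z) = n%:R%:E,
        forall i, Defs.eigenspace T z (e i) & lin_indep e]).
  have /choice[me meP] : forall z, exists me : {n : nat & 'I_n -> H},
      z \in s ->
      [/\ edim R (Defs.eigenspace T z) = (tag me)%:R%:E,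
        forall i, Defs.eigenspace T z (tagged me i) & lin_indep (tagged me)].
    move=> z; have [zX|_] := boolP (z \in s); last first.
      by exists (Tagged (fun n => 'I_n -> H) (fun _ : 'I_0 => 0)).
    by have [n [e h]] := att z zX; exists (Tagged (fun n => 'I_n -> H) e).
  rewrite (eq_big_seq (fun z => (tag (me z))%:R%:E)); last first.
    by move=> z /meP[].
  rewrite sumEFin -natr_sum.
  apply: (fam s (fun z => tag (me z)) (fun z => tagged (me z))) => //.
  by move=> z /meP[].
move=> /existsNP[z /not_implyP[zX natt]].
have [//|unb] := edim_attained_or_unbounded (Defs.eigenspace T z).
suff -> : N = +oo%E by rewrite leey.
apply/eqyP => A A0; have [n [e [An We ie]]] := unb (Num.bound A).
apply: (@le_trans _ _ n%:R%:E).
  rewrite lee_fin; apply/ltW/(lt_le_trans (archi_boundP (ltW A0))).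
  by rewrite ler_nat.
have -> : n = (\sum_(z <- [:: z]) n)%N by rewrite big_seq1.
apply: (fam [:: z] (fun=> n) (fun=> e)) => // y; rewrite inE => /eqP -> //.
exact: sX.
Qed.

End PositiveOperator.

End RealInnerProduct.

(** * Comparison of the counting functions *)

Theorem mainTheorem1 (R : realType) (H : completeNormedModType R[i])
    (ip : {dot H for conjC}) (hip : hilbert_ip ip)
    (T T' : operator H)
    (hTsa : self_adjoint ip T) (hTnn : nonnegative ip T)
    (hTcr : compactly_resolved T)
    (hT'sa : self_adjoint ip T') (hT'nn : nonnegative ip T')
    (hT'cr : compactly_resolved T')
    (hV : form_domain ip T' `<=` form_domain ip T)
    (ht : forall u : H, form_domain ip T' u ->
       qform ip T u u <= qform ip T' u u) :
  subspectral T T'.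
Proof.
move=> x; apply: (counting_le_families hip hT'sa) => I f find fx.
have [|v [a va]] := eigenfamily_exists hip hTsa hTnn hTcr find (x := x).
  move=> c u; have [du Tu] := fx c.
  have [Vu qu] := qform_le_op hip hT'sa hT'nn du.
  split; first exact: hV.
  have := ht _ Vu; rewrite lecE => /andP[_ tt].
  exact: le_trans tt (le_trans qu Tu).
exact: eigenfamily_le_counting va.
Qed.
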